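(* Let $2\le s\le t$ be integers and let $p>s$ be a real number. Then there exists $n_0=n_0(s,t,p)$ such that the following holds for all $n\ge n_0$. Let $G$ be a $K_{s,t}$-free graph on $n$ vertices. Then $G$ is an extremal graph with $e_p(G)=\mathrm{ex}_p(n,K_{s,t})$ if and only if $G=K_{s-1}\vee L$ for some near $(t-1)$-regular graph $L$ on $n-s+1$ vertices which does not contain any $K_{a,b}$ such that $2\le a\le\min\{b,s\}$ and $a+b=t+1$.
   Context: All graphs are finite, simple and undirected; containment means as a (not necessarily induced) subgraph; equality of graphs is up to isomorphism. $K_{a,b}$ is the complete bipartite graph with classes of sizes $a$ and $b$. A graph is $F$-free if it does not contain $F$ as a subgraph. For real $p>0$, $e_p(G)=\sum_{v\in V(G)}d_G(v)^p$, and $\mathrm{ex}_p(n,F)$ is the maximum of $e_p(G)$ over all $F$-free graphs $G$ on $n$ vertices; an extremal graph is an $F$-free graph on $n$ vertices attaining this maximum. The join $G\vee H$ is obtained from vertex-disjoint copies of $G$ and $H$ by adding all edges between them. A graph $L$ on $m$ vertices is near $\ell$-regular if it is $\ell$-regular when $\ell m$ is even, and otherwise has $m-1$ vertices of degree $\ell$ and one vertex of degree $\ell-1$. *)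

(* Defs.v *)
From HB Require Import structures.
From mathcomp Require Import all_boot all_order all_algebra.
From mathcomp Require Import all_classical all_reals all_analysis.

Set Implicit Arguments.
Unset Strict Implicit.
Unset Printing Implicit Defensive.

Import Order.TTheory GRing.Theory Num.Theory.
Local Open Scope classical_set_scope.
Local Open Scope ring_scope.

Record sgraph (V : finType) := SGraph {
  adj :> rel V;
  adj_sym : symmetric adj;
  adj_irr : irreflexive adj }.

Definition degree (V : finType) (G : sgraph V) (v : V) : nat := #|[pred w | G v w]|.

Definition contains_graph (V W : finType) (G : sgraph V) (F : sgraph W) : Prop :=
  exists f : W -> V, injective f /\ forall x y, F x y -> G (f x) (f y).

Definition graph_free (V W : finType) (F : sgraph W) (G : sgraph V) : Prop :=
  ~ contains_graph G F.

Definition graph_iso (V W : finType) (G : sgraph V) (H : sgraph W) : Prop :=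
  exists f : V -> W, bijective f /\ forall x y, H (f x) (f y) = G x y.

Definition complete_adj (n : nat) : rel 'I_n := fun x y => x != y.

Fact complete_sym n : symmetric (@complete_adj n).
Proof. by move=> x y; rewrite /complete_adj eq_sym. Qed.

Fact complete_irr n : irreflexive (@complete_adj n).
Proof. by move=> x; rewrite /complete_adj eqxx. Qed.

Definition complete_graph (n : nat) : sgraph 'I_n :=
  SGraph (@complete_sym n) (@complete_irr n).

Definition bipartite_adj (a b : nat) : rel ('I_a + 'I_b)%type := fun x y =>
  match x, y with inl _, inr _ | inr _, inl _ => true | _, _ => false end.

Fact bipartite_sym a b : symmetric (@bipartite_adj a b).
Proof. by move=> [x|x] [y|y]. Qed.

Fact bipartite_irr a b : irreflexive (@bipartite_adj a b).
Proof. by move=> [x|x]. Qed.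

Definition complete_bipartite (a b : nat) : sgraph ('I_a + 'I_b)%type :=
  SGraph (@bipartite_sym a b) (@bipartite_irr a b).

Definition join_adj (V W : finType) (G : sgraph V) (H : sgraph W) :
    rel (V + W)%type := fun x y =>
  match x, y with
  | inl v, inl v' => G v v'
  | inr w, inr w' => H w w'
  | _, _ => true
  end.

Fact join_sym (V W : finType) (G : sgraph V) (H : sgraph W) :
  symmetric (join_adj G H).
Proof. by move=> [x|x] [y|y] //=; exact: adj_sym. Qed.

Fact join_irr (V W : finType) (G : sgraph V) (H : sgraph W) :
  irreflexive (join_adj G H).
Proof. by move=> [x|x] /=; exact: adj_irr. Qed.

Definition graph_join (V W : finType) (G : sgraph V) (H : sgraph W) :
    sgraph (V + W)%type :=
  SGraph (join_sym G H) (join_irr G H).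

Definition near_regular (l : nat) (V : finType) (G : sgraph V) : Prop :=
  if odd (l * #|V|) then
    exists v : V, degree G v = l.-1 /\ forall w, w != v -> degree G w = l
  else forall v : V, degree G v = l.

Definition e_p (R : realType) (p : R) (V : finType) (G : sgraph V) : R :=
  \sum_(v : V) (degree G v)%:R `^ p.

(* The supremum is a maximum as soon as some F-free graph on n vertices
   exists; see [ex_p_attained] and [ex_p_ub]. *)
Definition ex_p (R : realType) (p : R) (n : nat) (W : finType) (F : sgraph W) :
    R :=
  sup [set e_p p H | H in [set H : sgraph 'I_n | graph_free F H]].

Definition extremal_graph (R : realType) (p : R) (n : nat) (W : finType)
    (F : sgraph W) (V : finType) (G : sgraph V) : Prop :=
  [/\ #|V| = n, graph_free F G & e_p p G = ex_p p n F].

Fact e_p_adj (R : realType) (p : R) (n : nat) (H : sgraph 'I_n) :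
  e_p p H = \sum_(v < n)
    #|[pred w | [ffun x => [ffun y => H x y]] v w]|%:R `^ p.
Proof.
apply: eq_bigr => v _; congr (_%:R `^ _); apply: eq_card => w.
by rewrite !inE !ffunE.
Qed.

Lemma ex_p_max (R : realType) (p : R) (n : nat) (W : finType) (F : sgraph W)
    (H0 : sgraph 'I_n) : graph_free F H0 ->
  exists2 H : sgraph 'I_n, graph_free F H &
    forall H' : sgraph 'I_n, graph_free F H' -> e_p p H' <= e_p p H.
Proof.
move=> F0.
pose enc (H : sgraph 'I_n) := [ffun x => [ffun y => H x y]].
pose e (A : {ffun 'I_n -> {ffun 'I_n -> bool}}) : R :=
  \sum_(v < n) #|[pred w | A v w]|%:R `^ p.
pose P A := `[< exists2 H : sgraph 'I_n, graph_free F H & enc H = A >].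
have P0 : P (enc H0) by apply/asboolP; exists H0.
have [A /asboolP[H FH <-] maxA] := @arg_maxP _ _ _ (enc H0) P e P0.
exists H => // H' FH'; rewrite !e_p_adj; apply: maxA.
by apply/asboolP; exists H'.
Qed.

Lemma ex_p_attained (R : realType) (p : R) (n : nat) (W : finType)
    (F : sgraph W) (H0 : sgraph 'I_n) : graph_free F H0 ->
  exists2 H : sgraph 'I_n, graph_free F H & e_p p H = ex_p p n F.
Proof.
move=> /(@ex_p_max R p)[H FH maxH]; exists H => //; apply/le_anti/andP; split.
- apply: ub_le_sup; last by exists H.
  by exists (e_p p H) => _ [H' /= FH' <-]; exact: maxH.
- apply: ge_sup; first by exists (e_p p H), H.
  by move=> _ [H' /= FH' <-]; exact: maxH.
Qed.

Lemma ex_p_ub (R : realType) (p : R) (n : nat) (W : finType)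
    (F : sgraph W) (H : sgraph 'I_n) : graph_free F H -> e_p p H <= ex_p p n F.
Proof.
move=> FH; have [H' _ maxH'] := @ex_p_max R p _ _ _ _ FH.
apply: ub_le_sup; last by exists H.
by exists (e_p p H') => _ [H1 /= FH1 <-]; exact: maxH'.
Qed.

(* Main.v *)
Require Import Defs.
From HB Require Import structures.
From mathcomp Require Import all_boot all_order all_algebra.
From mathcomp Require Import all_classical all_reals all_analysis.
From mathcomp Require Import zify lra.

Set Implicit Arguments.
Unset Strict Implicit.
Unset Printing Implicit Defensive.

Import Order.TTheory GRing.Theory Num.Theory.
Local Open Scope ring_scope.

(* Write [n] for the order of [G] and [c = s + t - 2].  Double counting of
   [s]-subsets gives, for every vertex set [D], that
   [\sum_v |N(v) :&: D| ^ s = O(|D| n ^ (s - 1))], so as [p > s] the vertices of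
   degree at most [e n] contribute only [O(e ^ (p - s) n ^ p)] to [e_p].  The
   boundedly many others have total degree at most [(s - 1) n + O(1)]; by
   convexity, if [e_p G >= (s - 1) (n - 1) ^ p], then exactly [s - 1] vertices
   have degree close to [n] and the rest have small degree.

   Let [A] be this set of [s - 1] vertices, [M] the number of its missing
   incidences and [D] the set of outer vertices not complete to [A], so that
   [|D| <= M].  An outer vertex [v] has at most [c + |N(v) :&: D|] neighbours,
   hence passing from [D] empty to [D] nonempty gains at most
   [O(\sum_v |N(v) :&: D| ^ p)], a small multiple of [|D| n ^ (p - 1)], whereas
   the missing incidences cost at least [M (n - 1) ^ (p - 1)].  So [M = 0] in an
   extremal graph, [G] is a join with [K_(s-1)], and the other factor has maximum
   degree at most [t - 1]; the sum of powers is then maximal exactly in the near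
   regular case.  The bound is attained because near regular graphs of girth at
   least 5 exist: a densest graph of girth at least 5 and maximum degree at most
   [l] has total deficiency at most 1, since otherwise an edge [xy] far from two
   deficient vertices [u], [v] could be replaced by [ux] and [vy]. *)

Local Open Scope nat_scope.

(** * Counting in [K_(s,t)]-free graphs *)

Definition nbrs (V : finType) (G : sgraph V) (D : {set V}) (v : V) : {set V} :=
  [set w in D | G v w].

Lemma degree_nbrs (V : finType) (G : sgraph V) v :
  degree G v = #|nbrs G [set: V] v|.
Proof. by apply: eq_card => w; rewrite !inE. Qed.

Lemma card_nbrs_le (V : finType) (G : sgraph V) D v : #|nbrs G D v| <= #|D|.
Proof. by apply/subset_leq_card/fintype.subsetP => w; rewrite inE => /andP[]. Qed.

(** Irreflexivity makes [S] and [T] disjoint automatically, and asking only for lower bounds on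
    their sizes avoids choosing subsets in later uses. *)
Lemma contains_bipartiteP (V : finType) (G : sgraph V) a b :
  contains_graph G (complete_bipartite a b) <->
  exists S T : {set V}, [/\ a <= #|S|, b <= #|T| &
    forall x y, x \in S -> y \in T -> G x y].
Proof.
split=> [[f [f_inj fG]]|[S [T [aS bT ST]]]].
  exists [set f (inl i) | i : 'I_a], [set f (inr j) | j : 'I_b].
  rewrite !card_imset ?cardT ?size_enum_ord; first last.
  - by move=> i j /f_inj[].
  - by move=> i j /f_inj[].
  split=> // _ _ /imsetP[i _ ->] /imsetP[j _ ->]; exact: fG.
pose f (x : 'I_a + 'I_b) : V := match x with
  | inl i => enum_val (widen_ord aS i) | inr j => enum_val (widen_ord bT j) end.
have fG i j : G (f (inl i)) (f (inr j)) by apply: ST; exact: enum_valP.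
exists f; split; last first.
  by move=> [i|i] [j|j] //= _; [|rewrite adj_sym]; exact: fG.
move=> [i|i] [j|j] /= fij.
- by move/enum_val_inj: fij => /(congr1 val) /= ij; congr inl; apply/val_inj.
- by have := fG i j; rewrite /= fij adj_irr.
- by have := fG j i; rewrite /= fij adj_irr.
- by move/enum_val_inj: fij => /(congr1 val) /= ij; congr inr; apply/val_inj.
Qed.

Lemma common_nbrs_lt (V : finType) (G : sgraph V) s t (S : {set V}) :
  graph_free (complete_bipartite s t) G -> #|S| = s ->
  #|[set v | S \subset nbrs G [set: V] v]| < t.
Proof.
move=> free cS; rewrite ltnNge; apply/negP => tT; apply: free.
apply/contains_bipartiteP.
exists S, [set v | S \subset nbrs G [set: V] v]; rewrite cS; split=> // x y xS.
by rewrite inE => /fintype.subsetP /(_ x xS); rewrite !inE adj_sym.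
Qed.

(** Double counting of the pairs of a vertex [v] and an [s]-subset of [D] inside its neighbourhood:
    each [s]-set has at most [t - 1] common neighbours. *)
Lemma sum_bin_nbrs (V : finType) (G : sgraph V) s t (D : {set V}) :
  graph_free (complete_bipartite s t) G ->
  \sum_v 'C(#|nbrs G D v|, s) <= t.-1 * 'C(#|D|, s).
Proof.
move=> free.
pose P (S : {set V}) := (S \subset D) && (#|S| == s).
have -> : \sum_v 'C(#|nbrs G D v|, s) =
    \sum_v \sum_(S : {set V} | P S) (S \subset nbrs G [set: V] v).
  apply: eq_bigr => v _.
  rewrite -cards_draws cardsE -sum1_card [RHS]big_mkcond [LHS]big_mkcond /=.
  apply: eq_bigr => S _; rewrite unfold_in /P /=.
  have -> : nbrs G D v = D :&: nbrs G [set: V] v.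
    by apply/setP => w; rewrite !inE.
  rewrite finset.subsetI.
  by case: (S \subset D) => //=; case: eqP => //=; case: (S \subset _).
rewrite exchange_big /=.
apply: (@leq_trans (\sum_(S : {set V} | P S) t.-1)); last first.
  by rewrite sum_nat_const -cards_draws cardsE mulnC.
apply: leq_sum => S /andP[_ /eqP cS].
have := common_nbrs_lt free cS.
rewrite -sum1dep_card big_mkcond /=.
have -> : \sum_(v : V) (if S \subset nbrs G [set: V] v then 1 else 0) =
    \sum_(v : V) (S \subset nbrs G [set: V] v) by apply: eq_bigr => v _; case: ifP.
by case: (t).
Qed.

(** From [d = s - 1] on, the binomial grows by at least 1 at each step. The additive constant
    [s - 1] becomes the sharp leading coefficient in [sum_degree_le]. *)
Lemma leq_bin_pred d s : 0 < s -> d <= s.-1 + 'C(d, s).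
Proof.
case: s => // s _ /=; elim: d => [//|d IH].
rewrite binS; have [sd|ds] := leqP s d.
  have : 0 < 'C(d, s) by rewrite bin_gt0.
  lia.
lia.
Qed.

(** Every factor [d - i] of the falling factorial has [i < s <= d], whence [d <= s * (d - i)]. *)
Lemma expn_le_ffact d s k : k <= s -> s <= d -> d ^ k <= s ^ k * d ^_ k.
Proof.
move=> + sd; elim: k => [//|k IH] ks.
have {}IH := IH (ltnW ks).
rewrite !expnSr ffactnSr.
have dk : d <= s * (d - k) by rewrite mulnBr; nia.
by rewrite mulnACA leq_mul.
Qed.

(** Turns the double count of [s]-subsets into a bound on [s]-th powers; the summand [d] covers
    [d < s], where the binomial vanishes. *)
Lemma expn_le_bin d s : 0 < s -> d ^ s <= s ^ s * s`! * (d + 'C(d, s)).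
Proof.
move=> s0; have [sd|ds] := leqP s d.
  apply: leq_trans (expn_le_ffact (leqnn s) sd) _.
  rewrite -bin_ffact -mulnA leq_mul2l; apply/orP; right.
  by rewrite mulnC leq_mul2l leq_addl orbT.
have s1 : 0 < s`! := fact_gt0 s.
case: s s0 ds s1 => // s _ ds s1.
apply: (@leq_trans (s.+1 ^ s.+1 * d)); last by rewrite -mulnA leq_mul2l; nia.
rewrite !expnSr; apply: leq_mul.
  apply: leq_trans (leq_pmulr _ _) => //.
  by case: s ds {s1} => // s ds; rewrite leq_exp2r // ltnW.
by [].
Qed.

Lemma bin_le_expn n k : 'C(n, k) <= n ^ k.
Proof.
apply: (@leq_trans (n ^_ k)); first by rewrite -bin_ffact leq_pmulr // fact_gt0.
elim: k => // k IH; rewrite ffactnSr expnSr leq_mul //; exact: leq_subr.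
Qed.

Lemma sum_card_nbrs (V : finType) (G : sgraph V) (D : {set V}) :
  \sum_v #|nbrs G D v| = \sum_(u in D) degree G u.
Proof.
transitivity (\sum_v \sum_(u in D) (G v u : nat)).
  apply: eq_bigr => v _; rewrite -sum1_card big_mkcond [RHS]big_mkcond /=.
  by apply: eq_bigr => u _; rewrite inE; case: (u \in D) => //=; case: (G v u).
rewrite exchange_big /=; apply: eq_bigr => u _.
rewrite /degree -sum1_card [RHS]big_mkcond /=.
by apply: eq_bigr => v _; rewrite inE adj_sym; case: (G u v).
Qed.

Lemma degree_lt (V : finType) (G : sgraph V) v : degree G v < #|V|.
Proof.
rewrite -[#|V|]cardsT (cardsD1 v) finset.in_setT add1n ltnS.
apply/subset_leq_card/fintype.subsetP => w; rewrite !inE andbT.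
by apply: contraTneq => ->; rewrite adj_irr.
Qed.

(** The linear dependence on [#|D|] is the point: with [D] the whole vertex set it leaves few
    vertices of large degree, and with [D] small it bounds what the deficient vertices can gain. *)
Lemma sum_expn_nbrs (V : finType) (G : sgraph V) s t (D : {set V}) :
  1 < s -> 0 < t -> graph_free (complete_bipartite s t) G ->
  \sum_v #|nbrs G D v| ^ s <= s ^ s * s`! * t * (#|D| * #|V| ^ s.-1).
Proof.
move=> s1 t0 free; have s0 : 0 < s := ltnW s1.
apply: (@leq_trans (\sum_v s ^ s * s`! * (#|nbrs G D v| + 'C(#|nbrs G D v|, s)))).
  by apply: leq_sum => v _; exact: expn_le_bin.
rewrite -big_distrr -[leqRHS]mulnA leq_mul2l; apply/orP; right.
rewrite big_split /= sum_card_nbrs.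
have DV : #|D| <= #|V| by rewrite max_card.
have le1 : \sum_(u in D) degree G u <= #|D| * #|V| ^ s.-1.
  apply: leq_trans (_ : _ <= #|D| * #|V|) _.
    by rewrite -sum_nat_const; apply: leq_sum => u _; exact/ltnW/degree_lt.
  rewrite leq_mul2l; apply/orP; right.
  have [->//|V0] := posnP #|V|.
  by rewrite -{1}(expn1 #|V|) leq_pexp2l //; case: s s1 {s0 free} => [|[]].
have le2 : 'C(#|D|, s) <= #|D| * #|V| ^ s.-1.
  apply: leq_trans (bin_le_expn _ _) _.
  rewrite -{1}(prednK s0) expnS leq_mul2l; apply/orP; right.
  by rewrite leq_exp2r // -ltnS prednK.
have := sum_bin_nbrs D free; case: t t0 {free} => // t _ /= h.
by rewrite mulSn leq_add // (leq_trans h) // leq_mul2l le2 orbT.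
Qed.

(** Meant for [D] of bounded size, where the second summand is a constant: each vertex sends at most
    [s - 1] edges to [D], up to a total excess controlled by the double count. *)
Lemma sum_degree_le (V : finType) (G : sgraph V) s t (D : {set V}) :
  0 < s -> graph_free (complete_bipartite s t) G ->
  \sum_(v in D) degree G v <= s.-1 * #|V| + t.-1 * #|D| ^ s.
Proof.
move=> s0 free; rewrite -sum_card_nbrs.
apply: (@leq_trans (\sum_v (s.-1 + 'C(#|nbrs G D v|, s)))).
  by apply: leq_sum => v _; exact: leq_bin_pred.
rewrite big_split /= sum_nat_const mulnC leq_add2l.
apply: leq_trans (sum_bin_nbrs D free) _; rewrite leq_mul2l; apply/orP; right.
exact: bin_le_expn.
Qed.

Lemma handshake (V : finType) (G : sgraph V) : ~~ odd (\sum_v degree G v).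
Proof.
(* Counts each edge once, oriented by increasing rank. *)
pose T := \sum_v \sum_(w | enum_rank v < enum_rank w) (G v w : nat).
suff -> : \sum_v degree G v = T + T by rewrite oddD addbb.
have -> : \sum_v degree G v = \sum_v \sum_w (G v w : nat).
  apply: eq_bigr => v _; rewrite /degree -sum1_card big_mkcond /=.
  by apply: eq_bigr => w _; rewrite inE; case: (G v w).
have {2}-> : T = \sum_v \sum_(w | enum_rank w < enum_rank v) (G v w : nat).
  rewrite /T (exchange_big_dep xpredT) //=; apply: eq_bigr => v _.
  by apply: eq_bigr => w _; rewrite adj_sym.
rewrite -big_split /=; apply: eq_bigr => v _.
rewrite (bigID (fun w => enum_rank v < enum_rank w)) /=; congr addn.
rewrite (bigD1 v) ?ltnn //= adj_irr add0n; apply: eq_bigl => w.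
rewrite -leqNgt ltn_neqAle andbC; congr andb.
by rewrite (inj_eq val_inj) (inj_eq enum_rank_inj).
Qed.

Lemma graph_iso_degree (V W : finType) (G : sgraph V) (H : sgraph W) f v :
  bijective f -> (forall x y, H (f x) (f y) = G x y) ->
  degree H (f v) = degree G v.
Proof.
move=> [g fK gK] fG; rewrite /degree -[RHS](fintype.card_image (can_inj fK)).
apply: eq_card => w; rewrite !inE; apply/idP/fintype.imageP => [Hw|[x]].
  by exists (g w); rewrite ?gK // inE -fG gK.
by rewrite inE -fG => Hx ->.
Qed.

Lemma degree_join_inl (V W : finType) (G : sgraph V) (H : sgraph W) v :
  degree (graph_join G H) (inl v) = degree G v + #|W|.
Proof.
rewrite /degree -!sum1_card !big_mkcond big_sumType /=; congr addn.
by rewrite [RHS]big_mkcond; apply: eq_bigr.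
Qed.

Lemma degree_join_inr (V W : finType) (G : sgraph V) (H : sgraph W) w :
  degree (graph_join G H) (inr w) = #|V| + degree H w.
Proof.
rewrite /degree -!sum1_card !big_mkcond big_sumType /=; congr addn.
by rewrite [RHS]big_mkcond; apply: eq_bigr.
Qed.

Lemma degree_complete n i : degree (complete_graph n) i = n.-1.
Proof.
rewrite /degree (eq_card (_ : _ =i predC1 i)) ?cardC1 ?card_ord // => j.
by rewrite !inE /= /complete_adj eq_sym.
Qed.

(** * Joins with a complete graph *)

Lemma graph_iso_sym (V W : finType) (G : sgraph V) (H : sgraph W) :
  graph_iso G H -> graph_iso H G.
Proof.
move=> [f [[g fK gK] fG]]; exists g; split; first by exists f.
by move=> x y; rewrite -fG !gK.
Qed.

Lemma graph_iso_free (V W U : finType) (G : sgraph V) (H : sgraph W)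
    (F : sgraph U) : graph_iso G H -> graph_free F G -> graph_free F H.
Proof.
move=> /graph_iso_sym[f [[g fK gK] fG]] free [h [h_inj hF]]; apply: free.
exists (f \o h); split; first exact: inj_comp (can_inj fK) h_inj.
by move=> x y /hF; rewrite /= fG.
Qed.

Lemma relabel (V : finType) (G : sgraph V) n : #|V| = n ->
  exists H : sgraph 'I_n, graph_iso G H.
Proof.
move=> <-; pose r : rel 'I_#|V| := fun i j => G (enum_val i) (enum_val j).
have rs : symmetric r by move=> i j; exact: adj_sym.
have ri : irreflexive r by move=> i; exact: adj_irr.
exists (SGraph rs ri), enum_rank; split.
  by exists enum_val; [exact: enum_rankK|exact: enum_valK].
by move=> x y; rewrite /= /r !enum_rankK.
Qed.

Lemma card_set_sum (V W : finType) (S : {set (V + W)%type}) :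
  #|S| = #|[set v | inl v \in S]| + #|[set w | inr w \in S]|.
Proof.
rewrite -!sum1_card big_mkcond big_sumType /=; congr addn;
  by rewrite [RHS]big_mkcond; apply: eq_bigr => x _; rewrite inE.
Qed.

(** This is the absence of 4-cycles, that is, of [K_(2,2)]. *)
Definition quad_free (V : finType) (G : sgraph V) : Prop :=
  forall x y u v, x != y -> u != v -> G x u -> G x v -> G y u -> ~~ G y v.

(** The two sides of a copy use at most [s - 1] core vertices together, so at least [t + 1] of its
    vertices lie in [L], some on each side. Two or more on both sides give a 4-cycle; a single one
    on some side gives a vertex of degree at least [t]. *)
Lemma join_quad_free_free (V : finType) (L : sgraph V) s t :
  0 < s <= t -> quad_free L -> (forall v, degree L v <= t.-1) ->
  graph_free (complete_bipartite s t) (graph_join (complete_graph s.-1) L).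
Proof.
move=> /andP[s0 st] quad degL /contains_bipartiteP[S [T [sS tT ST]]].
rewrite !card_set_sum in sS tT.
set S0 := [set v | inl v \in S] in sS; set S1 := [set v | inr v \in S] in sS.
set T0 := [set v | inl v \in T] in tT; set T1 := [set v | inr v \in T] in tT.
have ST1 x y : x \in S1 -> y \in T1 -> L x y.
  by rewrite !inE => xS yT; exact: ST xS yT.
have ST0 : #|S0| + #|T0| <= s.-1.
  rewrite -cardsUI (_ : S0 :&: T0 = finset.set0) ?cards0 ?addn0.
    by rewrite -[leqRHS]card_ord max_card.
  apply/setP => i; rewrite !inE; apply/negP => /andP[iS iT].
  by have := ST _ _ iS iT; rewrite /= /complete_adj eqxx.
have star (A B : {set V}) : #|A| = 1 -> (forall x y, x \in A -> y \in B -> L x y) ->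
    #|B| <= t.-1.
  move=> /eqP/cards1P[x ->] AB; apply: leq_trans (degL x).
  apply/subset_leq_card/fintype.subsetP => y yB.
  by rewrite inE; apply: AB; rewrite ?inE.
have [S2|S2] := ltnP 1 #|S1|; first have [T2|T2] := ltnP 1 #|T1|.
- have /card_gt1P[x [y [xS yS xy]]] := S2.
  have /card_gt1P[u [v [uT vT uv]]] := T2.
  by have /negP := quad _ _ _ _ xy uv (ST1 _ _ xS uT) (ST1 _ _ xS vT) (ST1 _ _ yS uT);
    apply; exact: ST1.
- have T1e : #|T1| = 1 by lia.
  have := star _ _ T1e (fun x y xT yS => etrans (adj_sym L x y) (ST1 y x yS xT)).
  lia.
- have S1e : #|S1| = 1 by lia.
  have := star _ _ S1e ST1; lia.
Qed.

Lemma card_ord_lt k m : m <= k -> #|[set i : 'I_k | i < m]| = m.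
Proof.
move=> mk; rewrite cardsE -sum1_card.
transitivity (\sum_(i < m) 1); last by rewrite sum1_card card_ord.
exact: esym (big_ord_widen k (fun=> 1) mk).
Qed.

(** Of the [s - 1] core vertices, [s - a] are added to the side of size [a] and [a - 1] to the side
    of size [b], giving sizes [s] and [a + b - 1 = t]. *)
Lemma join_free_bipartite (V : finType) (L : sgraph V) s t a b :
  graph_free (complete_bipartite s t) (graph_join (complete_graph s.-1) L) ->
  0 < a <= s -> a + b = t.+1 -> ~ contains_graph L (complete_bipartite a b).
Proof.
move=> free /andP[a0 as_] ab /contains_bipartiteP[S [T [aS bT ST]]].
apply: free; apply/contains_bipartiteP.
pose in_S (z : 'I_s.-1 + V) := match z with inl i => i < s - a | inr v => v \in S end.
pose in_T (z : 'I_s.-1 + V) := match z with inl i => s - a <= i | inr v => v \in T end.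
exists [set z | in_S z], [set z | in_T z].
have card_inl (P : pred ('I_s.-1 + V)) :
    #|[set z | P z]| = #|[set i | P (inl i)]| + #|[set v | P (inr v)]|.
  by rewrite card_set_sum; congr addn; apply: eq_card => i; rewrite !inE.
have low : #|[set i : 'I_s.-1 | i < s - a]| = s - a by rewrite card_ord_lt; lia.
have high : #|[set i : 'I_s.-1 | s - a <= i]| = a.-1.
  have -> : [set i : 'I_s.-1 | s - a <= i] = ~: [set i : 'I_s.-1 | i < s - a].
    by apply/setP => i; rewrite !inE -leqNgt.
  by rewrite cardsCs finset.setCK low card_ord; lia.
rewrite !card_inl /= low high; split.
- rewrite (_ : [set v | v \in S] = S); first lia.
  by apply/setP => v; rewrite inE.
- rewrite (_ : [set v | v \in T] = T); first lia.
  by apply/setP => v; rewrite inE.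
- move=> [i|v] [j|w]; rewrite !inE //=; last exact: ST.
  by move=> il jl; rewrite /complete_adj; apply: contraTneq il => ->; rewrite -leqNgt.
Qed.

Lemma join_free_degree (V : finType) (L : sgraph V) s t v :
  0 < s -> 0 < t ->
  graph_free (complete_bipartite s t) (graph_join (complete_graph s.-1) L) ->
  degree L v <= t.-1.
Proof.
move=> s0 t0 free; rewrite leqNgt; apply/negP; rewrite prednK // => dv.
have := @join_free_bipartite V L s t 1 t free; rewrite s0 add1n.
apply=> //; apply/contains_bipartiteP.
exists [set v], (nbrs L [set: V] v); rewrite cards1 -degree_nbrs; split=> //.
by move=> x y; rewrite !inE => /eqP-> /andP[].
Qed.

Lemma graph_iso_join (V : finType) (G : sgraph V) (A : {set V}) k m :
  #|A| = k -> #|V| = k + m -> (forall a, a \in A -> degree G a = #|V|.-1) ->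
  exists L : sgraph 'I_m, graph_iso G (graph_join (complete_graph k) L).
Proof.
move=> cA cV full.
have cC : m = #|~: A| by rewrite cardsCs finset.setCK cV cA addKn.
have Gfull a v : a \in A -> a != v -> G a v.
  move=> /full da av; have : [pred w | G a w] =i predC1 a.
    apply/subset_cardP; first by rewrite cardC1.
    apply/fintype.subsetP => w; rewrite !inE.
    by apply: contraTneq => ->; rewrite adj_irr.
  by move=> /(_ v); rewrite !inE eq_sym av.
pose g (z : 'I_k + 'I_m) : V := match z with
  | inl i => enum_val (cast_ord (esym cA) i)
  | inr j => enum_val (cast_ord cC j) end.
have g_inl i : g (inl i) \in A by exact: enum_valP.
have g_inr j : g (inr j) \notin A by have := enum_valP (cast_ord cC j); rewrite inE.
have g_inj : injective g.
  move=> [i|i] [j|j] gij.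
  - by move/enum_val_inj: gij => /cast_ord_inj ->.
  - by have := g_inl i; rewrite gij (negPf (g_inr j)).
  - by have := g_inl j; rewrite -gij (negPf (g_inr i)).
  - by move/enum_val_inj: gij => /cast_ord_inj ->.
pose r : rel 'I_m := fun i j => G (g (inr i)) (g (inr j)).
have rs : symmetric r by move=> i j; exact: adj_sym.
have ri : irreflexive r by move=> i; exact: adj_irr.
exists (SGraph rs ri); apply: graph_iso_sym; exists g; split.
  by apply: inj_card_bij => //; rewrite card_sum !card_ord cV.
move=> [i|i] [j|j] //=.
- rewrite /complete_adj; have [<-|ij] := eqVneq i j; first by rewrite adj_irr.
  apply: (Gfull (g (inl i)) (g (inl j)) (g_inl i)).
  by apply: contra_neq ij => /g_inj[].
- apply: (Gfull (g (inl i)) (g (inr j)) (g_inl i)).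
  by apply: contraTneq (g_inl i) => ->.
- rewrite adj_sym; apply: (Gfull (g (inl j)) (g (inr i)) (g_inl j)).
  by apply: contraTneq (g_inl j) => ->.
Qed.

(** * Near regular graphs of girth at least 5 *)

(** Triangles are excluded along with 4-cycles for the sake of [far_switch]. *)
Definition girth5 (V : finType) (G : sgraph V) : Prop :=
  quad_free G /\ forall x y z, G x y -> G y z -> ~~ G x z.

(** The conjunct [a != b] keeps the relation irreflexive even if [u = x]. *)
Definition add_adj (V : finType) (G : sgraph V) (u x : V) : rel V := fun a b =>
  G a b || (a != b) && ((a == u) && (b == x) || (a == x) && (b == u)).

Fact add_sym (V : finType) (G : sgraph V) u x : symmetric (add_adj G u x).
Proof.
by move=> a b; rewrite /add_adj adj_sym eq_sym orbC [(b == u) && _]andbC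
  [(b == x) && _]andbC [X in _ && X]orbC orbC.
Qed.

Fact add_irr (V : finType) (G : sgraph V) u x : irreflexive (add_adj G u x).
Proof. by move=> a; rewrite /add_adj adj_irr eqxx. Qed.

Definition add_edge (V : finType) (G : sgraph V) u x :=
  SGraph (@add_sym V G u x) (@add_irr V G u x).

Definition del_adj (V : finType) (G : sgraph V) (x y : V) : rel V := fun a b =>
  G a b && ~~ ((a == x) && (b == y) || (a == y) && (b == x)).

Fact del_sym (V : finType) (G : sgraph V) x y : symmetric (del_adj G x y).
Proof.
by move=> a b; rewrite /del_adj adj_sym [(b == x) && _]andbC
  [(b == y) && _]andbC [X in ~~ X]orbC.
Qed.

Fact del_irr (V : finType) (G : sgraph V) x y : irreflexive (del_adj G x y).
Proof. by move=> a; rewrite /del_adj adj_irr. Qed.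

Definition del_edge (V : finType) (G : sgraph V) x y :=
  SGraph (@del_sym V G x y) (@del_irr V G x y).

Lemma degree_sum (V : finType) (G : sgraph V) a :
  degree G a = \sum_b (G a b : nat).
Proof.
rewrite /degree -sum1_card big_mkcond; apply: eq_bigr => b _.
by rewrite inE; case: (G a b).
Qed.

Lemma sum_eq_nat (V : finType) (x : V) (b : bool) :
  \sum_z ((b && (z == x)) : nat) = b.
Proof.
rewrite (bigD1 x) //= eqxx andbT big1 ?addn0 // => z /negPf ->.
by rewrite andbF.
Qed.

Lemma degree_add (V : finType) (G : sgraph V) u x a : u != x -> ~~ G u x ->
  degree (add_edge G u x) a = degree G a + ((a == u) + (a == x)).
Proof.
move=> ux nG; rewrite !degree_sum -[nat_of_bool (a == u)](sum_eq_nat x).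
rewrite -[nat_of_bool (a == x)](sum_eq_nat u) -!big_split /=.
apply: eq_bigr => b _; rewrite /add_adj.
have [/andP[/eqP-> /eqP->]|_] := boolP ((a == u) && (b == x)).
  by rewrite (negPf nG) ux (negPf ux).
have [/andP[/eqP-> /eqP->]|_] := boolP ((a == x) && (b == u)).
  by rewrite adj_sym (negPf nG) eq_sym ux.
by rewrite andbF orbF !addn0.
Qed.

Lemma degree_del (V : finType) (G : sgraph V) x y a : G x y ->
  degree (del_edge G x y) a + ((a == x) + (a == y)) = degree G a.
Proof.
move=> Gxy; have xy : x != y by apply: contraTneq Gxy => ->; rewrite adj_irr.
rewrite !degree_sum -[nat_of_bool (a == x)](sum_eq_nat y).
rewrite -[nat_of_bool (a == y)](sum_eq_nat x) -!big_split /=.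
apply: eq_bigr => b _; rewrite /del_adj.
have [/andP[/eqP-> /eqP->]|_] := boolP ((a == x) && (b == y)).
  by rewrite Gxy (negPf xy).
have [/andP[/eqP-> /eqP->]|_] := boolP ((a == y) && (b == x)).
  by rewrite adj_sym Gxy.
by rewrite andbT !addn0.
Qed.

(** Lazy steps may stay in place, so three of them reach exactly the distances up to 3, and [far]
    means distance at least 4. *)
Definition lazy (V : finType) (G : sgraph V) : rel V :=
  fun a b => (a == b) || G a b.

Definition far (V : finType) (G : sgraph V) (u x : V) : Prop :=
  forall a b, lazy G u a -> lazy G a b -> ~~ lazy G b x.

Lemma add_edgeP (V : finType) (G : sgraph V) u x a b : add_edge G u x a b ->
  [\/ G a b, a = u /\ b = x | a = x /\ b = u].
Proof.
rewrite /= /add_adj => /orP[|/andP[_ /orP[]/andP[/eqP-> /eqP->]]].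
- by constructor 1.
- by constructor 2.
- by constructor 3.
Qed.

(** A triangle or 4-cycle through the new edge would contain a path of length at most 3 between [u]
    and [x] in the old graph. *)
Lemma girth5_add (V : finType) (G : sgraph V) u x :
  girth5 G -> far G u x -> girth5 (add_edge G u x).
Proof.
move=> [quad tri] Far.
have lz0 a : lazy G a a by rewrite /lazy eqxx.
have lz1 a b : G a b -> lazy G a b by rewrite /lazy orbC => ->.
have lz1' a b : G a b -> lazy G b a by rewrite adj_sym; exact: lz1.
have F a b : lazy G u a -> lazy G a b -> lazy G b x -> False.
  by move=> ua ab bx; have := Far _ _ ua ab; rewrite bx.
have lzs a b : lazy G a b -> lazy G b a by rewrite /lazy eq_sym adj_sym.
have F' a b : lazy G x a -> lazy G a b -> lazy G b u -> False.
  by move=> /lzs xa /lzs ab /lzs bu; exact: F bu ab xa.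
have irr a : G a a -> False by rewrite adj_irr.
have Q a b c d : a <> b -> c <> d -> G a c -> G a d -> G b c -> G b d -> False.
  by move=> /eqP ab /eqP cd ac ad bc bd; have := quad _ _ _ _ ab cd ac ad bc; rewrite bd.
have T a b c : G a b -> G b c -> G a c -> False.
  by move=> ab bc ac; have := tri _ _ _ ab bc; rewrite ac.
split=> [a b c d /eqP ab /eqP cd ac ad bc|a b c ab bc].
  apply/negP => bd; move: ac ad bc bd.
  (* Each edge of the cycle is old or is the new edge in one of two orientations; [F] and [F']
     exclude the remaining old path, padded by [lz0]. *)
  do 4 (case/add_edgeP=> [?|[? ?]|[? ?]]); subst;
    try (by []); try (by eauto 2); try by eauto 5 using F, F', lz0.
apply/negP => ac; move: ab bc ac.
do 3 (case/add_edgeP=> [?|[? ?]|[? ?]]); subst;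
  try (by []); try (by eauto 2); try by eauto 5 using F, F', lz0.
Qed.

Lemma lazy_refl (V : finType) (G : sgraph V) a : lazy G a a.
Proof. by rewrite /lazy eqxx. Qed.

Lemma far_not_adjacent (V : finType) (G : sgraph V) u x :
  far G u x -> u != x /\ ~~ G u x.
Proof.
by move=> /(_ u u (lazy_refl _ _) (lazy_refl _ _)); rewrite /lazy => /norP[].
Qed.

Lemma girth5_del (V : finType) (G : sgraph V) x y :
  girth5 G -> girth5 (del_edge G x y).
Proof.
have sub a b : del_edge G x y a b -> G a b by case/andP.
move=> [quad tri]; split=> [a b c d ab cd /sub ac /sub ad /sub bc|a b c /sub ab /sub bc].
  by apply: contra (quad _ _ _ _ ab cd ac ad bc); exact: sub.
by apply: contra (tri _ _ _ ab bc); exact: sub.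
Qed.

(* A walk from [v] to [y] of length at most 3 that uses the new edge [ux] ends
   with a walk of length at most 2 from [x] to [y], which without the edge [xy]
   would close a triangle. *)
Lemma far_switch (V : finType) (G : sgraph V) u v x y :
  girth5 G -> G x y -> far G u y -> far G v y ->
  far (add_edge (del_edge G x y) u x) v y.
Proof.
move=> [quad tri] Gxy Fu Fv a b va ab; apply/negP => b_y.
(* A step of [G] other than the one from [x] to [y]; the walk considered runs towards [y]. *)
pose old c d := lazy G c d /\ ~ (c = x /\ d = y).
have step c d : lazy (add_edge (del_edge G x y) u x) c d ->
    [\/ old c d, c = u /\ d = x | c = x /\ d = u].
  have xy : x != y by apply: contraTneq Gxy => ->; rewrite adj_irr.
  move=> /orP[/eqP->|/add_edgeP[/andP[Gcd /norP[ncd _]]|?|?]].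
  - constructor 1; split; first exact: lazy_refl.
    by move=> [-> e]; rewrite e eqxx in xy.
  - constructor 1; split; first by rewrite /lazy Gcd orbT.
    by move=> [cx dy]; rewrite cx dy !eqxx in ncd.
  - by constructor 2.
  - by constructor 3.
have FuF c d : lazy G u c -> lazy G c d -> lazy G d y -> False.
  by move=> uc cd; apply/negP; exact: (Fu c d).
have FvF c d : lazy G v c -> lazy G c d -> lazy G d y -> False.
  by move=> uc cd; apply/negP; exact: (Fv c d).
have l0 c := lazy_refl G c.
have xyF : old x y -> False by move=> [_]; apply.
have xxyF c : old x c -> old c y -> False.
  move=> xc cy; have [/orP[/eqP e|xc1] _] := xc; first by subst.
  have [/orP[/eqP e|cy1] _] := cy; first by subst.
  by have := tri _ _ _ xc1 cy1; rewrite Gxy.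
have {}b_y := step _ _ b_y; have {}ab := step _ _ ab; have {}va := step _ _ va.
have irr c : G c c -> False by rewrite adj_irr.
have oldl c d : old c d -> lazy G c d by case.
case: b_y => [b_y|[? ?]|[? ?]]; subst; [|by eauto|by eauto using FuF].
case: ab => [ab|[? ?]|[? ?]]; subst; [|by eauto|by eauto using FuF].
case: va => [va|[? ?]|[? ?]]; subst; [by eauto using FvF|by eauto|by eauto using FuF].
Qed.

Definition ball_step (V : finType) (G : sgraph V) (S : {set V}) : {set V} :=
  [set y | [exists x in S, lazy G x y]].

Lemma card_ball_step (V : finType) (G : sgraph V) l S :
  (forall v, degree G v <= l) -> #|ball_step G S| <= #|S| * l.+1.
Proof.
move=> dG.
rewrite -sum_nat_const.
apply: (@leq_trans (\sum_(x in S) #|[set y | lazy G x y]|)).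
  rewrite -sum1_card; under [leqRHS]eq_bigr do rewrite -sum1_card.
  rewrite big_mkcond [leqRHS](exchange_big_dep xpredT) //=.
  apply: leq_sum => y _; rewrite inE; case: existsP => // -[x /andP[xS xy]].
  by rewrite (bigD1 x) ?xS ?inE ?xy.
apply: leq_sum => x _.
have -> : [set y | lazy G x y] = x |: nbrs G [set: V] x.
  by apply/setP => y; rewrite !inE eq_sym.
by rewrite cardsU1 -degree_nbrs -add1n leq_add // leq_b1.
Qed.

Lemma ball_step_far (V : finType) (G : sgraph V) (S : {set V}) u x :
  u \in S -> x \notin iter 3 (ball_step G) S -> far G u x.
Proof.
have stepP (T : {set V}) a b : a \in T -> lazy G a b -> b \in ball_step G T.
  by move=> aT ab; rewrite inE; apply/existsP; exists a; rewrite aT.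
move=> uS xn a b ua ab; apply: contra xn => bx.
exact: stepP (stepP _ _ _ (stepP _ _ _ uS ua) ab) bx.
Qed.

Lemma card_ball (V : finType) (G : sgraph V) l S k :
  (forall v, degree G v <= l) -> #|iter k (ball_step G) S| <= #|S| * l.+1 ^ k.
Proof.
move=> dG; elim: k => [|k IH]; first by rewrite muln1.
apply: leq_trans (card_ball_step _ dG) _.
by rewrite expnSr mulnA leq_mul2r IH orbT.
Qed.

(** The case [u = v] stands for one vertex of deficiency at least 2. If some edge [xy] has an end
    outside the ball of radius 4 around [u] and [v], it is replaced by [ux] and [vy], which raises
    only the degrees of [u] and [v]. Otherwise all vertices outside the ball are isolated, the size
    hypothesis provides two, and these are joined. *)
Lemma girth5_augment (V : finType) (G : sgraph V) l u v :
  2 * l.+1 ^ 4 + 2 <= #|V| -> girth5 G ->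
  (forall a, degree G a + ((a == u) + (a == v)) <= l) ->
  exists G' : sgraph V, [/\ girth5 G', forall a, degree G' a <= l &
    \sum_a degree G a < \sum_a degree G' a].
Proof.
move=> cV gG dG.
have dGl a : degree G a <= l by apply: leq_trans (dG a); exact: leq_addr.
pose near k := iter k (ball_step G) [set u; v].
have cW : 1 < #|~: near 4|.
  have h : #|near 4| <= 2 * l.+1 ^ 4.
    apply: leq_trans (card_ball _ _ dGl) _; rewrite leq_mul2r cards2.
    by case: (u != v); rewrite orbT.
  have := cardsC (near 4); move: h cV.
  by move: (l.+1 ^ 4) => q; lia.
have sum_eq (a : V) : \sum_b (b == a : nat) = 1.
  exact: (sum_eq_nat a true).
have near_sub k : near k \subset near k.+1.
  apply/fintype.subsetP => a ak; rewrite inE; apply/existsP; exists a.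
  by rewrite ak lazy_refl.
have [/existsP[x /existsP[y /andP[]]]|iso] :=
    boolP [exists x, exists y, (x \notin near 4) && G x y].
  move=> xn Gxy.
  (* As [x] is outside radius 4, its neighbour [y] is outside radius 3, which is what [far]
     requires. *)
  have yn : y \notin near 3.
    apply: contra xn => yn; rewrite /near iterS inE; apply/existsP; exists y.
    by rewrite yn /lazy adj_sym Gxy orbT.
  have xn3 : x \notin near 3 by apply: contra xn; exact: (fintype.subsetP (near_sub 3)).
  have Fux : far G u x by apply: ball_step_far xn3; rewrite !inE eqxx.
  have Fuy : far G u y by apply: ball_step_far yn; rewrite !inE eqxx.
  have Fvy : far G v y by apply: ball_step_far yn; rewrite !inE eqxx orbT.
  pose G1 := del_edge G x y; pose G2 := add_edge G1 u x.
  have G1G a b : G1 a b -> G a b by case/andP.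
  have G1l a b : lazy G1 a b -> lazy G a b.
    by rewrite /lazy => /orP[->//|/G1G ->]; rewrite orbT.
  have F1 : far G1 u x.
    move=> a b /G1l ua /G1l ab; apply: contra (Fux _ _ ua ab); exact: G1l.
  have F2 : far G2 v y := far_switch gG Gxy Fuy Fvy.
  have [ux nux] := far_not_adjacent F1; have [vy nvy] := far_not_adjacent F2.
  have deg a : degree (add_edge G2 v y) a = degree G a + ((a == u) + (a == v)).
    rewrite degree_add // degree_add // -(degree_del a Gxy) -/G1.
    move: (degree G1 a) (nat_of_bool (a == u)) (nat_of_bool (a == v)).
    by move: (nat_of_bool (a == x)) (nat_of_bool (a == y)) => *; lia.
  exists (add_edge G2 v y); split.
  - apply: girth5_add F2; apply: girth5_add F1; exact: girth5_del.
  - by move=> a; rewrite deg.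
  - rewrite (eq_bigr _ (fun a _ => deg a)) !big_split /= !sum_eq; lia.
have /card_gt1P[x [y [xn yn xy]]] := cW.
rewrite finset.in_setC in xn; rewrite finset.in_setC in yn.
have isoP z w : z \notin near 4 -> ~~ G z w.
  move=> zn; apply: contra iso => zw; apply/existsP; exists z.
  by apply/existsP; exists w; rewrite zn.
have lzP z w : z \notin near 4 -> lazy G z w -> w = z.
  by move=> zn; rewrite /lazy (negPf (isoP _ _ zn)) orbF => /eqP.
have F : far G x y.
  move=> a b /(lzP _ _ xn) -> /(lzP _ _ xn) ->.
  by apply: contra xy => /(lzP _ _ xn) ->.
have d0 z : z \notin near 4 -> degree G z = 0.
  by move=> zn; apply: eq_card0 => w; rewrite inE (negPf (isoP _ _ zn)).
have deg a : degree (add_edge G x y) a = degree G a + ((a == x) + (a == y)).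
  by rewrite degree_add // isoP.
(* [u] has room for another edge, so [l] is positive and the two isolated vertices may get degree
   1. *)
have l0 : 0 < l by apply: leq_trans (dG u); rewrite eqxx addnA addnAC addn1.
exists (add_edge G x y); split.
- exact: girth5_add.
- move=> a; rewrite deg.
  have [->|ax] := eqVneq a x; first by rewrite d0 // (negPf xy).
  by have [->|ay] := eqVneq a y; [rewrite d0|rewrite addn0].
- rewrite (eq_bigr _ (fun a _ => deg a)) !big_split /= !sum_eq; lia.
Qed.

Lemma near_regular_degree_le l (V : finType) (G : sgraph V) v :
  near_regular l G -> degree G v <= l.
Proof.
rewrite /near_regular; case: odd => [[u [du dG]]|->//].
by have [->|/dG->//] := eqVneq v u; rewrite du leq_pred.
Qed.

(** By the handshake lemma the total deficiency has the parity of [l * #|V|], so it is 0 in the even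
    case and 1, at a single vertex, in the odd case. *)
Lemma near_regularP l (V : finType) (G : sgraph V) :
  (forall v, degree G v <= l) -> \sum_v (l - degree G v) <= 1 ->
  near_regular l G.
Proof.
move=> dG def1.
have sumE : \sum_v degree G v + \sum_v (l - degree G v) = l * #|V|.
  rewrite -big_split /= (eq_bigr (fun=> l)) ?sum_nat_const 1?mulnC // => v _.
  exact: subnKC.
have odd_def : odd (l * #|V|) = odd (\sum_v (l - degree G v)).
  by rewrite -sumE oddD (negPf (handshake G)).
rewrite /near_regular odd_def.
case: ltngtP def1 => // [|def1 _].
  rewrite ltnS leqn0 => /eqP def0 _; rewrite def0 /= => v.
  by move/eqP: def0; rewrite sum_nat_eq0 => /forallP/(_ v) /=; have := dG v; lia.
rewrite def1 /=.
have [v dv] : exists v, 0 < l - degree G v.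
  apply/existsP; apply: contra_eqT def1 => /existsPn h.
  by rewrite big1 // => v _; have := h v; lia.
exists v; move: def1; rewrite (bigD1 v) //= => def1; split.
  by have := dG v; lia.
move=> w wv; move: def1; rewrite (bigD1 w) //=.
by have := dG w; move: (\sum_(_ | _) _) => q; lia.
Qed.

Lemma exists_near_regular l : exists m0, forall m, m0 <= m ->
  exists L : sgraph 'I_m, near_regular l L /\ quad_free L.
Proof.
exists (2 * l.+1 ^ 4 + 2) => m m0.
pose good (G : sgraph 'I_m) := girth5 G /\ forall v, degree G v <= l.
pose P k := `[< exists2 G : sgraph 'I_m, good G & \sum_v degree G v = k >].
have nosym : symmetric (fun _ _ : 'I_m => false) by [].
have noirr : irreflexive (fun _ _ : 'I_m => false) by [].
have d0 v : degree (SGraph nosym noirr) v = 0 by exact: eq_card0.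
have exP : exists k, P k.
  exists 0; apply/asboolP; exists (SGraph nosym noirr).
    by split=> [|v]; [split|rewrite d0].
  by rewrite big1 // => v _; rewrite d0.
have ubP k : P k -> k <= m * l.
  move=> /asboolP[G [_ dG] <-]; rewrite -[m in m * l]card_ord -sum_nat_const.
  exact: leq_sum.
case: (ex_maxnP exP ubP) => k /asboolP[L [gL dL] kL] maxk.
exists L; split; last by case: gL.
apply: near_regularP => //; rewrite leqNgt; apply/negP => def2.
(* Two units of deficiency sit either at one vertex, taken twice, or at two distinct vertices. *)
have [u [v duv]] : exists u v, forall a, degree L a + ((a == u) + (a == v)) <= l.
  have [u du] : exists u, 0 < l - degree L u.
    apply/existsP; apply: contraLR def2 => /existsPn h.
    by rewrite big1 // => v _; have := h v; lia.
  have [du2|du2] := ltnP 1 (l - degree L u).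
    by exists u, u => a; have := dL a; have [->|] := eqVneq a u; lia.
  have [v] : exists v, (v != u) && (0 < l - degree L v).
    apply/existsP; apply: contraLR def2 => /existsPn h.
    rewrite -leqNgt (bigD1 u) //= big1 ?addn0 // => w wu.
    by have := h w; rewrite wu /=; lia.
  move=> /andP[vu dv]; exists u, v => a; have := dL a.
  have [->|au] := eqVneq a u; first by rewrite eq_sym (negPf vu); lia.
  by have [->|av] := eqVneq a v; lia.
have [|L' [gL' dL' lt]] := girth5_augment _ gL duv; first by rewrite card_ord.
have : P (\sum_v degree L' v) by apply/asboolP; exists L'.
by move=> /maxk; rewrite -kL leqNgt lt.
Qed.

(** * Vertices outside the high degree set *)

Definition deficient (V : finType) (G : sgraph V) (A : {set V}) : {set V} :=
  [set w | (w \notin A) && ~~ (A \subset nbrs G [set: V] w)].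

(** A neighbour of [v] lies in [A], or is deficient, or is a common neighbour of the [s + 1]
    vertices of [v |: A]; there are at most [t - 1] of the last kind. *)
Lemma degree_outside (V : finType) (G : sgraph V) s t (A : {set V}) v :
  0 < t -> graph_free (complete_bipartite s.+1 t) G -> #|A| = s -> v \notin A ->
  degree G v <= s + t.-1 + #|nbrs G (deficient G A) v|.
Proof.
move=> t0 free cA vA.
have cvA : #|v |: A| = s.+1 by rewrite cardsU1 vA cA.
have := common_nbrs_lt free cvA; rewrite -ltnS => lt.
have sub : nbrs G [set: V] v \subset
    A :|: [set w | v |: A \subset nbrs G [set: V] w] :|: nbrs G (deficient G A) v.
  apply/fintype.subsetP => w; rewrite !inE /= => vw; case: (boolP (w \in A)) => //= wA.
  rewrite vw andbT finset.subUset finset.sub1set !inE adj_sym vw /=.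
  by case: (A \subset _).
rewrite degree_nbrs; apply: leq_trans (subset_leq_card sub) _.
apply: leq_trans (leq_card_setU _ _) _; rewrite leq_add2r.
apply: leq_trans (leq_card_setU _ _) _; rewrite cA leq_add2l.
by move: lt; rewrite ltnS; case: (t) t0.
Qed.

(** Every deficient vertex accounts for at least one missing incidence with [A]. *)
Lemma card_deficient (V : finType) (G : sgraph V) (A : {set V}) :
  #|deficient G A| <= \sum_(a in A) (#|V|.-1 - degree G a).
Proof.
set D := deficient G A.
apply: (@leq_trans (\sum_(a in A) \sum_(w in D) (~~ G a w : nat))).
  rewrite exchange_big /= -sum1_card; apply: leq_sum => w.
  rewrite inE => /andP[_ /fintype.subsetPn[a aA]]; rewrite !inE /= => naw.
  by rewrite (bigD1 a) //= adj_sym naw.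
apply: leq_sum => a aA.
have -> : \sum_(w in D) (~~ G a w : nat) = #|[set w in D | ~~ G a w]|.
  rewrite -sum1_card big_mkcond [RHS]big_mkcond; apply: eq_bigr => w _.
  by rewrite !inE; case: (w \notin A) => //=; case: (_ \subset _) => //=; case: (G a w).
rewrite leq_subRL; last by have := degree_lt G a; lia.
rewrite degree_nbrs -cardsUI (_ : _ :&: _ = finset.set0) ?cards0 ?addn0; last first.
  by apply/setP => w; rewrite !inE; case: (G a w); rewrite ?andbF.
have -> : #|V|.-1 = #|[set~ a]| by rewrite cardsC1.
apply/subset_leq_card/fintype.subsetP => w; rewrite !inE /= => /orP[|/andP[/andP[wA _] _]].
  by apply: contraTneq => ->; rewrite adj_irr.
by apply: contraNneq wA => ->.
Qed.

Local Open Scope ring_scope.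

(** * Real power sums *)

Lemma le_powR (R : realType) (p x y : R) : 0 <= p -> 0 <= x -> x <= y ->
  x `^ p <= y `^ p.
Proof.
move=> p0 x0 xy; apply: ge0_ler_powR => //; rewrite nnegrE //.
exact: le_trans xy.
Qed.

Lemma small_powR (R : realType) (q e : R) : 0 < q -> 0 < e ->
  exists2 d : R, 0 < d <= 2^-1 & d `^ q <= e.
Proof.
move=> q0 e0; exists (Num.min 2^-1 (e `^ q^-1)).
  by rewrite lt_min powR_gt0 // ge_min lexx invr_gt0 ltr0n.
apply: (@le_trans _ _ ((e `^ q^-1) `^ q)).
  apply: le_powR; rewrite ?ge_min ?lexx ?orbT ?(ltW q0) //.
  by rewrite le_min powR_ge0 invr_ge0 ler0n.
by rewrite -powRrM mulVf ?gt_eqF // powRr1 // ltW.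
Qed.

Lemma exists_nat_ge (R : realType) (x : R) : exists k : nat, x <= k%:R.
Proof.
exists (Num.bound `|x|); apply: le_trans (ler_norm _) _.
by rewrite ltW // archi_boundP.
Qed.

Lemma eventually_ge (R : realType) (C e : R) : 0 < e ->
  exists n0 : nat, forall n : nat, (n0 <= n)%N -> C <= e * n%:R.
Proof.
move=> e0; have [n0 n0P] := exists_nat_ge (C / e); exists n0 => n n0n.
by rewrite mulrC -ler_pdivrMr // (le_trans n0P) // ler_nat.
Qed.

Lemma bernoulli_le (R : realType) (y : R) n : 0 <= y <= 1 ->
  1 - n%:R * y <= (1 - y) ^+ n.
Proof.
move=> /andP[y0 y1]; elim: n => [|n IH]; first by rewrite mul0r subr0 expr0.
rewrite exprS; apply: (@le_trans _ _ ((1 - y) * (1 - n%:R * y))).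
  have : 0 <= n%:R * (y * y) by rewrite mulr_ge0 ?mulr_ge0.
  by rewrite -natr1; lra.
by apply: ler_wpM2l => //; rewrite subr_ge0.
Qed.

(* Both sums being close to [k] forces [x (1 - x) <= x - x ^ p] to be small, so
   each [x v] is close to 0 or to 1. *)
Lemma concentrate (R : realType) (V : finType) (x : V -> R) (H : {set V}) (p g : R)
    (k : nat) :
  2 <= p -> 0 < g -> (4 * k%:R + 5) * g < 1 -> (forall v, 0 <= x v <= 1) ->
  \sum_(v in H) x v <= k%:R + g -> k%:R - g <= \sum_(v in H) x v `^ p ->
  exists2 A : {set V}, #|A| = k & forall a, a \in A -> 1 - 4 * g <= x a.
Proof.
move=> p2 g0 gk x01 sum1 sump.
have xp v : x v `^ p <= x v ^+ 2.
  have /andP[x0 x1] := x01 v; rewrite -powR_mulrn //.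
  have [->|xn0] := eqVneq (x v) 0; first by rewrite !powR0 // gt_eqF //; lra.
  by apply: ger_powR => //; rewrite x1 andbT lt_neqAle eq_sym xn0 x0.
have gap v : x v * (1 - x v) <= x v - x v `^ p.
  by have := xp v; rewrite expr2; lra.
have gap0 v : 0 <= x v * (1 - x v).
  by have /andP[x0 x1] := x01 v; rewrite mulr_ge0 ?subr_ge0.
have gapS : \sum_(v in H) x v * (1 - x v) <= 2 * g.
  apply: (@le_trans _ _ (\sum_(v in H) (x v - x v `^ p))).
    by apply: ler_sum => v _; exact: gap.
  by rewrite sumrB; lra.
have gapv v : v \in H -> x v * (1 - x v) <= 2 * g.
  move=> vH; apply: le_trans gapS; rewrite (bigD1 v) //= lerDl.
  by apply: sumr_ge0 => w _.
(* On this set [1 - x v <= 2 * x v * (1 - x v)], and on the rest of [H]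
   [x v <= 2 * x v * (1 - x v)]. *)
pose A := [set v in H | 2^-1 <= x v].
have near1 a : a \in A -> 1 - 4 * g <= x a.
  rewrite inE => /andP[aH xa]; have /andP[_ x1] := x01 a.
  have : 0 <= (1 - x a) * (x a - 2^-1) by rewrite mulr_ge0 ?subr_ge0.
  by have := gapv a aH; lra.
have sumHA : \sum_(v in H) x v = \sum_(v in A) x v + \sum_(v in H | ~~ (2^-1 <= x v)) x v.
  rewrite (bigID (fun v => 2^-1 <= x v)) /=; congr (_ + _).
  by apply: eq_bigl => v; rewrite inE.
have small : \sum_(v in H | ~~ (2^-1 <= x v)) x v <= 4 * g.
  apply: (@le_trans _ _ (2 * \sum_(v in H) x v * (1 - x v))); last by lra.
  rewrite mulr_sumr [leRHS](bigID (fun v => 2^-1 <= x v)) /=.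
  apply: (@le_trans _ _ (\sum_(v in H | ~~ (2^-1 <= x v)) 2 * (x v * (1 - x v)))).
    apply: ler_sum => v /andP[_]; rewrite -ltNge => xv.
    have /andP[x0 _] := x01 v.
    have : 0 <= x v * (2^-1 - x v) by rewrite mulr_ge0 ?subr_ge0 // ltW.
    by lra.
  by rewrite lerDr; apply: sumr_ge0 => v _; rewrite mulr_ge0.
have small0 : 0 <= \sum_(v in H | ~~ (2^-1 <= x v)) x v.
  by apply: sumr_ge0 => v _; have /andP[] := x01 v.
have sump1 : \sum_(v in H) x v `^ p <= \sum_(v in H) x v.
  by apply: ler_sum => v _; have := gap v; have := gap0 v; lra.
have A_le : \sum_(v in A) x v <= #|A|%:R.
  rewrite -sum1_card natr_sum; apply: ler_sum => v _.
  by have /andP[] := x01 v.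
have A_ge : #|A|%:R * (1 - 4 * g) <= \sum_(v in A) x v.
  rewrite mulr_natl -sumr_const; apply: ler_sum => v; exact: near1.
have kg : 0 <= k%:R * g by rewrite mulr_ge0 // ltW.
exists A; last exact: near1.
(* If [#|A| > k], then [(k + 1) * (1 - 4 * g) <= k + g], contradicting [(4 * k + 5) * g < 1]. If
   [#|A| < k], then [k - g <= (k - 1) + 4 * g], that is [1 <= 5 * g]. *)
apply/eqP; rewrite eqn_leq; apply/andP; split; rewrite leqNgt; apply/negP.
  move=> kA; have kA1 : k%:R + 1 <= #|A|%:R :> R by rewrite natr1 ler_nat.
  have : 0 <= (#|A|%:R - (k%:R + 1)) * (1 - 4 * g).
    by rewrite mulr_ge0 ?subr_ge0 //; lra.
  by lra.
move=> kA; have : #|A|%:R + 1 <= k%:R :> R by rewrite natr1 ler_nat.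
by lra.
Qed.

(** * Locating the vertices of high degree *)

(** The degrees divided by [n] are fed to [concentrate], with [H] the set of those above a threshold
    [e]; the size of [H] is bounded independently of [n]. *)
Lemma high_degree_vertices (R : realType) (s t : nat) (p g : R) :
  (1 < s)%N -> (0 < t)%N -> s%:R < p -> 0 < g -> (4 * s.-1%:R + 5) * g < 1 ->
  exists n0 : nat, forall n : nat, (n0 <= n)%N ->
  forall (V : finType) (G : sgraph V), #|V| = n ->
  graph_free (complete_bipartite s t) G -> s.-1%:R * n.-1%:R `^ p <= e_p p G ->
  exists2 A : {set V}, #|A| = s.-1 &
    forall a, a \in A -> (1 - 4 * g) * n%:R <= (degree G a)%:R.
Proof.
move=> s1 t0 sp g0 gs.
pose kap : R := (s ^ s * s`! * t)%:R.
have s0 : (0 < s)%N by exact: ltnW.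
have kap0 : 0 < kap by rewrite ltr0n !muln_gt0 expn_gt0 s0 fact_gt0 t0.
have s2 : 2 <= s%:R :> R by rewrite ler_nat.
have p2 : 2 <= p by lra.
(* With this [e], vertices below the threshold contribute at most [e ^ (p - s) * kap <= g / 2], as
   [kap] bounds the sum of the [s]-th powers; [K] below bounds the number of the others. *)
have [e /andP[e0 e1] eg] : exists2 e : R, 0 < e <= 2^-1 & e `^ (p - s%:R) <= g / 2 / kap.
  by apply: small_powR; [lra|rewrite !divr_gt0].
have [K Kge] := exists_nat_ge (kap / e ^+ s).
(* A natural exponent above [p], so that Bernoulli's inequality bounds [(1 - 1 / n) ^ p] from below;
   [n2] makes the resulting loss at most [g / 2]. *)
have [P Pge] := exists_nat_ge p.
have [n1 n1P] := @eventually_ge R (t.-1 * K ^ s)%:R g g0.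
have [n2 n2P] : exists n0 : nat, forall n : nat, (n0 <= n)%N ->
    s.-1%:R * P%:R <= g / 2 * n%:R by apply: eventually_ge; lra.
exists (maxn 2 (maxn n1 n2)) => n; rewrite !geq_max => /andP[n_gt1 /andP[n1n n2n]].
have n0 : (0 < n)%N := ltnW n_gt1.
move=> V G cV free epG.
have n0' : 0 < n%:R :> R by rewrite ltr0n.
pose x v : R := (degree G v)%:R / n%:R.
have xn v : (degree G v)%:R = n%:R * x v by rewrite mulrC divfK // gt_eqF.
have x01 v : 0 <= x v <= 1.
  rewrite divr_ge0 ?ler0n // ler_pdivrMr // mul1r ler_nat -cV.
  exact/ltnW/degree_lt.
have xs : \sum_v x v ^+ s <= kap.
  have := @sum_expn_nbrs V G s t [set: V] s1 t0 free.
  rewrite cardsT cV -expnS prednK // -(ler_nat R) natrM -/kap natr_sum natrX => h.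
  rewrite -(ler_pM2r (exprn_gt0 s n0')) mulr_suml; apply: le_trans h.
  apply: ler_sum => v _; rewrite -degree_nbrs natrX xn -exprMn [x v * _]mulrC //.
pose H := [set v | e < x v].
have HK : (#|H| <= K)%N.
  rewrite -(ler_nat R); apply: le_trans Kge; rewrite ler_pdivlMr ?exprn_gt0 //.
  apply: le_trans xs; rewrite (bigID (mem H)) /= mulr_natl -sumr_const.
  apply: (@le_trans _ _ (\sum_(v in H) x v ^+ s)).
    apply: ler_sum => v; rewrite inE => /ltW ev.
    by apply: lerXn2r; rewrite ?nnegrE ?(ltW e0) // (le_trans (ltW e0)).
  rewrite lerDl; apply: sumr_ge0 => v _.
  by rewrite exprn_ge0 //; have /andP[] := x01 v.
have sumH1 : \sum_(v in H) x v <= s.-1%:R + g.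
  rewrite -mulr_suml ler_pdivrMr // -natr_sum.
  apply: (@le_trans _ _ (s.-1 * n + t.-1 * K ^ s)%:R).
    rewrite ler_nat -cV; apply: leq_trans (sum_degree_le H s0 free) _.
    by rewrite leq_add2l leq_mul2l leq_exp2r // HK orbT.
  by rewrite natrD natrM; have := n1P n n1n; lra.
have np0 : 0 < n%:R `^ p by exact: powR_gt0.
have sumVp : s.-1%:R - g / 2 <= \sum_v x v `^ p.
  have y0 : 0 <= n%:R^-1 :> R by rewrite invr_ge0.
  have y1 : n%:R^-1 < 1 :> R by rewrite invf_lt1 // ltr1n.
  have n1E : n.-1%:R = n%:R * (1 - n%:R^-1) :> R.
    rewrite mulrBr mulr1 divff ?gt_eqF //.
    by rewrite -{2}(prednK n0) -natr1; lra.
  have bern : 1 - P%:R / n%:R <= (1 - n%:R^-1) `^ p.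
    apply: le_trans (bernoulli_le P _) _; first by rewrite y0 ltW.
    rewrite -powR_mulrn; last by rewrite subr_ge0 ltW.
    by apply: ger_powR => //; rewrite subr_gt0 y1 gerBl.
  have := epG; rewrite /e_p n1E powRM //; last by rewrite subr_ge0 ltW.
  have -> : \sum_v (degree G v)%:R `^ p = n%:R `^ p * \sum_v x v `^ p.
    rewrite mulr_sumr; apply: eq_bigr => v _; rewrite xn powRM //.
    by have /andP[] := x01 v.
  rewrite mulrCA ler_pM2l //; apply: le_trans.
  apply: le_trans (_ : s.-1%:R * (1 - P%:R / n%:R) <= _); last exact: ler_wpM2l.
  have : s.-1%:R * (P%:R / n%:R) <= g / 2 by rewrite mulrA ler_pdivrMr // n2P.
  by lra.
have low : \sum_(v in ~: H) x v `^ p <= g / 2.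
  apply: (@le_trans _ _ (\sum_(v in ~: H) e `^ (p - s%:R) * x v ^+ s)).
    apply: ler_sum => v; rewrite !inE -leNgt => xe.
    have /andP[x0 _] := x01 v.
    have -> : x v `^ p = x v `^ (p - s%:R) * x v ^+ s.
      rewrite -powR_mulrn // -powRD ?subrK // gt_eqF //; lra.
    by apply: ler_wpM2r; [exact: exprn_ge0|apply: le_powR => //; lra].
  rewrite -mulr_sumr; apply: (@le_trans _ _ (g / 2 / kap * kap)); last first.
    by rewrite divfK // gt_eqF.
  apply: ler_pM => //; first exact: powR_ge0.
    by apply: sumr_ge0 => v _; rewrite exprn_ge0 //; have /andP[] := x01 v.
  apply: le_trans xs; rewrite [leRHS](bigID (mem (~: H))) /= lerDl.
  by apply: sumr_ge0 => v _; rewrite exprn_ge0 //; have /andP[] := x01 v.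
have sumHp : s.-1%:R - g <= \sum_(v in H) x v `^ p.
  move: sumVp; rewrite (bigID (mem H)) /=.
  have -> : \sum_(v | v \notin H) x v `^ p = \sum_(v in ~: H) x v `^ p.
    by apply: eq_bigl => v; rewrite [in RHS]inE.
  by lra.
have [A cA near1] := concentrate p2 g0 gs x01 sumH1 sumHp.
exists A => // a /near1 h.
by rewrite xn [leLHS]mulrC ler_pM2l.
Qed.

(** For [x >= 1] already [c + x <= c.+1 * x]. The crude factor is harmless, since the sum of the
    powers of [x] will carry an arbitrarily small coefficient. *)
Lemma powR_add_le (R : realType) (p : R) (c x : nat) : 0 < p ->
  (c + x)%:R `^ p <= c%:R `^ p + c.+1%:R `^ p * x%:R `^ p.
Proof.
move=> p0; case: x => [|x].
  by rewrite addn0 powR0 ?gt_eqF // mulr0 addr0.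
rewrite -powRM // -natrM; apply: (@le_trans _ _ ((c.+1 * x.+1)%:R `^ p)).
  by apply: le_powR; [exact: ltW|exact: ler0n|rewrite ler_nat; nia].
by rewrite lerDr powR_ge0.
Qed.

(** The lower bound credits [n - s] of the [n - s + 1] outer vertices with full degree, since a near
    regular graph may have one vertex of smaller degree. *)
Lemma high_degree_full (R : realType) (s t : nat) (p : R) :
  (1 < s)%N -> (0 < t)%N -> s%:R < p ->
  exists2 d : R, 0 < d & exists n0 : nat, forall n : nat, (n0 <= n)%N ->
  forall (V : finType) (G : sgraph V) (A : {set V}), #|V| = n ->
  graph_free (complete_bipartite s t) G -> #|A| = s.-1 ->
  (forall a, a \in A -> (1 - d) * n%:R <= (degree G a)%:R) ->
  s.-1%:R * n.-1%:R `^ p + (n - s)%:R * (s.-1 + t.-1)%:R `^ p <= e_p p G ->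
  forall a, a \in A -> degree G a = n.-1.
Proof.
move=> s1 t0 sp.
pose kap : R := (s ^ s * s`! * t)%:R.
have s0 : (0 < s)%N by exact: ltnW.
have kap0 : 0 < kap by rewrite ltr0n !muln_gt0 expn_gt0 s0 fact_gt0 t0.
have s2 : 2 <= s%:R :> R by rewrite ler_nat.
have regroup (a b c' m z : R) : a * (b * m * (c' * z)) = 2 * (a * b * c') * (m * z / 2).
  by lra.
have ps : 0 < p - s%:R by lra.
have p1 : 1 <= p by lra.
have p0 : 0 < p by lra.
have pm1 : 0 <= p - 1 by lra.
have pm1' : 1 <= p - 1 by lra.
set c := (s.-1 + t.-1)%N.
pose C : R := c.+1%:R `^ p.
have C0 : 0 < C by rewrite powR_gt0.
have two0 : 0 < 2 `^ (p - 1) :> R by rewrite powR_gt0.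
(* Chosen so that the gain due to deficient vertices is at most half of the loss [M * y]; the choice
   [d = th / s] then yields [M <= th * n]. *)
have [th /andP[th0 _] thP] : exists2 th : R, 0 < th <= 2^-1 &
    th `^ (p - s%:R) <= (2 * (C * kap * 2 `^ (p - 1)))^-1.
  by apply: small_powR; [exact: ps|rewrite invr_gt0 !mulr_gt0].
exists (th / s%:R); first by rewrite divr_gt0 ?ltr0n.
have [n1 n1P] : exists n0 : nat, forall n : nat, (n0 <= n)%N ->
   2 * c%:R `^ p + 2 <= 1 * n%:R by exact: eventually_ge.
exists (maxn s n1) => n; rewrite geq_max => /andP[sn n1n].
have nsE : (n - s.-1)%N = (n - s).+1 by rewrite -subSn // -{2}(prednK s0) subSS.
move=> V G A cV free cA hA epG.
have n_gt1 : (1 < n)%N by exact: leq_trans s1 sn.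
have n0 : 0 < n%:R :> R by rewrite ltr0n ltnW.
set D := deficient G A.
set M := (\sum_(a in A) (n.-1 - degree G a))%N.
have DM : (#|D| <= M)%N by rewrite /M -cV; exact: card_deficient.
have deg_lt v : (degree G v <= n.-1)%N 
  by rewrite -ltnS prednK ?(ltnW n_gt1) // -cV degree_lt.
have Mth : M%:R <= th * n%:R.
  rewrite natr_sum; apply: (@le_trans _ _ (\sum_(a in A) (th / s%:R * n%:R))).
    apply: ler_sum => a aA; rewrite natrB //; have := hA a aA.
    have : n.-1%:R <= n%:R :> R by rewrite ler_nat leq_pred.
    by lra.
  rewrite sumr_const cA -[_ *+ s.-1]mulr_natl mulrA ler_pM2r // mulrCA ler_piMr ?(ltW th0) //.
  by rewrite ler_pdivrMr ?ltr0n // mul1r ler_nat leq_pred.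
pose y : R := n.-1%:R `^ (p - 1).
have y0 : 0 <= y by exact: powR_ge0.
have sumA : \sum_(a in A) (degree G a)%:R `^ p <= s.-1%:R * n.-1%:R `^ p - M%:R * y.
  have -> : s.-1%:R * n.-1%:R `^ p - M%:R * y =
      \sum_(a in A) (n.-1%:R `^ p - (n.-1 - degree G a)%:R * y).
    by rewrite sumrB sumr_const cA mulr_natl /M natr_sum mulr_suml.
  (* Writing [x ^ p] as [x * x ^ (p - 1)], a vertex of degree [d] loses at least
     [(n - 1 - d) * (n - 1) ^ (p - 1)]. *)
  apply: ler_sum => a _; rewrite natrB // mulrBl.
  rewrite -(mulr_powRB1 (ler0n R n.-1) p0) -(mulr_powRB1 (ler0n R (degree G a)) p0).
  rewrite opprB addrCA -/y subrr addr0; apply: ler_wpM2l => //.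
  by apply: le_powR => //; rewrite ler_nat.
have sumD : \sum_v #|nbrs G D v|%:R `^ p <=
    (2 * (C * kap * 2 `^ (p - 1)))^-1 * (kap * #|D|%:R * n%:R `^ (p - 1)).
  (* Since [#|nbrs G D v| <= #|D| <= M <= th * n], the power [p - s] is split off and
     [sum_expn_nbrs] handles the remaining [s]-th powers. *)
  apply: (@le_trans _ _ (\sum_v (th * n%:R) `^ (p - s%:R) * (#|nbrs G D v| ^ s)%:R)).
    apply: ler_sum => v _.
    have -> : #|nbrs G D v|%:R `^ p =
        #|nbrs G D v|%:R `^ (p - s%:R) * (#|nbrs G D v| ^ s)%:R :> R.
      by rewrite natrX -powR_mulrn // -powRD ?subrK // gt_eqF.
    apply: ler_wpM2r => //; apply: le_powR => //; first exact: ltW.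
    apply: le_trans Mth; rewrite ler_nat; apply: leq_trans DM; exact: card_nbrs_le.
  rewrite -mulr_sumr -natr_sum (powRM _ (ltW th0) (ltW n0)) -mulrA.
  apply: ler_pM => //; first exact: powR_ge0.
  have -> : n%:R `^ (p - 1) = n%:R `^ (p - s%:R) * (n ^ s.-1)%:R :> R.
    rewrite natrX -powR_mulrn // -powRD; last by rewrite (gt_eqF n0) implybT.
    by congr (_ `^ _); rewrite -subn1 natrB // addrA subrK.
  rewrite mulrCA; apply: ler_wpM2l; first exact: powR_ge0.
  rewrite -mulrA -!natrM ler_nat -cV; exact: sum_expn_nbrs.
(* From [n <= 2 * (n - 1)]; this is the source of the factor [2 ^ (p - 1)] in the choice of [th]. *)
have ny : n%:R `^ (p - 1) <= 2 `^ (p - 1) * y.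
  rewrite -powRM //; apply: le_powR => //.
  rewrite -natrM ler_nat; case: (n) n_gt1 => [|[]]// k _.
  by rewrite mul2n -addnn addSnnS leq_addl.
have CsumD : C * (\sum_v #|nbrs G D v|%:R `^ p) <= M%:R * y / 2.
  apply: (@le_trans _ _ (C * ((2 * (C * kap * 2 `^ (p - 1)))^-1 *
      (kap * M%:R * (2 `^ (p - 1) * y))))).
    apply: ler_wpM2l; first exact: ltW.
    apply: le_trans sumD _; apply: ler_wpM2l.
      by rewrite invr_ge0 !mulr_ge0 // ltW.
    apply: ler_pM => //; first by rewrite mulr_ge0 // ltW.
    by rewrite ler_wpM2l ?(ltW kap0) // ler_nat.
  set T := 2 `^ (p - 1); rewrite mulrCA.
  by rewrite regroup mulKf // gt_eqF // !mulr_gt0.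
have sumB : \sum_(v in ~: A) (degree G v)%:R `^ p <=
    (n - s.-1)%:R * c%:R `^ p + C * (\sum_v #|nbrs G D v|%:R `^ p).
  have -> : (n - s.-1)%:R * c%:R `^ p = \sum_(v in ~: A) c%:R `^ p.
    by rewrite sumr_const cardsCs finset.setCK cV cA mulr_natl.
  rewrite mulr_sumr; apply: (@le_trans _ _
    (\sum_(v in ~: A) (c%:R `^ p + C * #|nbrs G D v|%:R `^ p))).
    apply: ler_sum => v; rewrite inE => vA.
    apply: le_trans (powR_add_le _ _ p0).
    apply: le_powR; rewrite ?ler0n //; first exact: ltW.
    rewrite ler_nat; apply: degree_outside => //.
    by rewrite prednK.
  rewrite big_split /= lerD2l [leRHS](bigID (mem (~: A))) /= lerDl.
  by apply: sumr_ge0 => v _; rewrite mulr_ge0 ?powR_ge0.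
have : e_p p G <= s.-1%:R * n.-1%:R `^ p + (n - s.-1)%:R * c%:R `^ p - M%:R * y / 2.
  rewrite /e_p (bigID (mem A)) /=.
  have -> : \sum_(v | v \notin A) (degree G v)%:R `^ p =
      \sum_(v in ~: A) (degree G v)%:R `^ p :> R.
    by apply: eq_bigl => v; rewrite [in RHS]inE.
  lra.
move=> /(le_trans epG).
(* Comparing the two bounds leaves [M * y / 2 <= c ^ p], from the one uncredited outer vertex. As
   [y >= n - 1], a positive [M] is impossible for large [n]. *)
have -> : (n - s.-1)%:R = (n - s)%:R + 1 :> R by rewrite natr1 nsE.
move=> Mle.
have M0 : M = 0%N.
  apply/eqP; rewrite -leqn0 leqNgt; apply/negP => M1.
  have yM : y <= M%:R * y by rewrite ler_peMl // ler1n.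
  have yn : n.-1%:R <= y by apply: le1r_powR; rewrite // ler1n -ltnS prednK // ltnW.
  have := n1P n n1n; have : n%:R = n.-1%:R + 1 :> R by rewrite natr1 prednK // ltnW.
  lra.
move=> a aA; apply/eqP; rewrite eqn_leq deg_lt /= -subn_eq0.
by move/eqP: M0; rewrite /M sum_nat_eq0 => /forallP/(_ a); rewrite aA.
Qed.

(** * Power sums of joins with near regular graphs *)

Lemma e_p_iso (R : realType) (p : R) (V W : finType) (G : sgraph V) (H : sgraph W) :
  graph_iso G H -> e_p p G = e_p p H.
Proof.
move=> [f [f_bij fG]]; rewrite /e_p (reindex f) /=; last exact: onW_bij.
by apply: eq_bigr => v _; rewrite (graph_iso_degree v f_bij fG).
Qed.

Lemma e_p_join_complete (R : realType) (p : R) k (W : finType) (L : sgraph W) :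
  e_p p (graph_join (complete_graph k) L) =
  k%:R * (k.-1 + #|W|)%:R `^ p + \sum_w (k + degree L w)%:R `^ p.
Proof.
rewrite /e_p big_sumType /=; congr (_ + _).
  under eq_bigr do rewrite degree_join_inl degree_complete.
  by rewrite sumr_const card_ord mulr_natl.
by apply: eq_bigr => w _; rewrite degree_join_inr card_ord.
Qed.

(** The contribution to [e_p] of a near [l]-regular graph on [m] vertices joined to [k] further
    vertices; the parity, read as 0 or 1, merges both cases. *)
Definition near_regular_sum (R : realType) (p : R) (k l m : nat) : R :=
  (m - odd (l * m))%:R * (k + l)%:R `^ p + (odd (l * m))%:R * (k + l.-1)%:R `^ p.

Lemma near_regular_sumE (R : realType) (p : R) k l (W : finType) (L : sgraph W) :
  near_regular l L ->
  \sum_w (k + degree L w)%:R `^ p = near_regular_sum p k l #|W|.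
Proof.
rewrite /near_regular /near_regular_sum; case: odd => [[v [dv dL]]|dL]; last first.
  rewrite subn0 mul0r addr0 mulr_natl -sumr_const.
  by apply: eq_bigr => w _; rewrite dL.
rewrite mul1r (bigD1 v) //= dv addrC; congr (_ + _).
rewrite mulr_natl subn1 -(cardC1 v) -sumr_const.
by apply: eq_bigr => w /dL ->.
Qed.

(** If [l * #|W|] is even, any vertex of degree below [l] pushes the sum strictly under the bound.
    If it is odd, the handshake lemma forces such a vertex, and any further loss is again strict. *)
Lemma near_regular_sum_max (R : realType) (p : R) k l (W : finType) (L : sgraph W) :
  0 < p -> (forall w, (degree L w <= l)%N) ->
  near_regular_sum p k l #|W| <= \sum_w (k + degree L w)%:R `^ p ->
  near_regular l L.
Proof.
move=> p0 dL.
pose g d : R := (k + d)%:R `^ p.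
have g_lt d d' : (d < d')%N -> g d < g d'.
  move=> dd; apply: gt0_ltr_powR; rewrite ?nnegrE ?ler0n //.
  by rewrite ltr_nat ltn_add2l.
have g_le d d' : (d <= d')%N -> g d <= g d'.
  by rewrite leq_eqVlt => /predU1P[->//|/g_lt/ltW].
have others (v : W) : \sum_(w | w != v) g l = (#|W|.-1)%:R * g l.
  by rewrite mulr_natl -(cardC1 v) -sumr_const; apply: eq_bigl => w; rewrite inE.
have rest (v : W) : \sum_(w | w != v) g (degree L w) <= (#|W|.-1)%:R * g l.
  by rewrite -(others v); apply: ler_sum => w _; exact: g_le.
have W0 (v : W) : (0 < #|W|)%N by apply/card_gt0P; exists v.
rewrite /near_regular /near_regular_sum -/(g l) -/(g l.-1).
rewrite -/(\sum_w g (degree L w)).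
have parity := handshake L.
case: (boolP (odd (l * #|W|))) => [odd_lW|_]; last first.
  rewrite subn0 mul0r addr0 => sum_ge v; apply/eqP; rewrite eqn_leq dL leqNgt.
  apply/negP => /g_lt dv; move: sum_ge; rewrite (bigD1 v) //= leNgt => /negP; apply.
  by rewrite -(prednK (W0 v)) -natr1 mulrDl mul1r addrC ler_ltD.
rewrite subn1 mul1r => sum_ge.
have [v dv] : exists v, (degree L v < l)%N.
  apply/existsP; apply: contraLR parity => /existsPn full.
  rewrite negbK (eq_bigr (fun=> l)) ?sum_nat_const 1?mulnC // => v _.
  by apply/eqP; rewrite eqn_leq dL leqNgt full.
have dv1 : (degree L v <= l.-1)%N by case: (l) dv.
move: sum_ge; rewrite (bigD1 v) //= [leRHS]addrC => sum_ge.
exists v; split.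
  apply/eqP; rewrite eqn_leq dv1 leqNgt; apply/negP => /g_lt lt.
  by move: sum_ge; rewrite leNgt => /negP; apply; exact: ler_ltD.
move=> w wv; apply/eqP; rewrite eqn_leq dL leqNgt; apply/negP => /g_lt lt.
move: sum_ge; rewrite leNgt => /negP; apply; apply: ltr_leD (g_le _ _ dv1).
rewrite -(others v) (bigD1 w) //= [ltRHS](bigD1 w) //=.
by apply: ltr_leD => //; apply: ler_sum => x _; exact: g_le.
Qed.

(** * Characterisation of the extremal graphs *)

(** Assuming a lower bound on [e_p] instead of extremality lets this apply both to the given graph
    and to an unknown maximiser. *)
Lemma extremal_structure (R : realType) (s t : nat) (p : R) :
  (1 < s)%N -> (0 < t)%N -> s%:R < p ->
  exists n0 : nat, forall n : nat, (n0 <= n)%N ->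
  forall (V : finType) (G : sgraph V), #|V| = n ->
  graph_free (complete_bipartite s t) G ->
  s.-1%:R * n.-1%:R `^ p + near_regular_sum p s.-1 t.-1 (n - s + 1) <= e_p p G ->
  exists2 L : sgraph 'I_(n - s + 1), near_regular t.-1 L &
    graph_iso G (graph_join (complete_graph s.-1) L).
Proof.
move=> s1 t0 sp; have s0 : (0 < s)%N := ltnW s1.
have p0 : 0 < p by apply: le_lt_trans sp.
have [d d0 [n1 full]] := @high_degree_full R s t p s1 t0 sp.
pose b : R := 4 * s.-1%:R + 5.
have b0 : 0 < b by rewrite ltr_wpDl // mulr_ge0.
(* The first term makes degrees of at least [(1 - 4 * g) * n] high enough for [high_degree_full];
   the second meets the smallness condition of [high_degree_vertices]. *)
pose g := Num.min (d / 4) (b^-1 / 2).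
have g0 : 0 < g by rewrite lt_min !divr_gt0 // invr_gt0.
have gd : 4 * g <= d by rewrite mulrC -ler_pdivlMr // ge_min lexx.
have gb : b * g < 1.
  apply: (@le_lt_trans _ _ (b * (b^-1 / 2))).
    by rewrite ler_pM2l // ge_min lexx orbT.
  by rewrite mulrA divff ?gt_eqF // mul1r invf_lt1 // ltr1n.
have [n2 high] := high_degree_vertices s1 t0 sp g0 gb.
exists (maxn s (maxn n1 n2)) => n; rewrite !geq_max => /andP[sn /andP[n1n n2n]].
move=> V G cV free epG.
have nr0 : (n - s)%:R * (s.-1 + t.-1)%:R `^ p <=
    near_regular_sum p s.-1 t.-1 (n - s + 1).
  rewrite /near_regular_sum; apply: ler_wpDr; first by rewrite mulr_ge0 ?powR_ge0.
  apply: ler_wpM2r; first exact: powR_ge0.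
  by rewrite ler_nat; case: odd; rewrite ?addnK // subn0 leq_addr.
have [|A cA hA] := high n n2n V G cV free.
  apply: le_trans epG; rewrite lerDl; apply: le_trans nr0.
  by rewrite mulr_ge0 ?powR_ge0.
have fullA : forall a, a \in A -> degree G a = n.-1.
  apply: (full n n1n V G A) => //.
    move=> a /hA; apply: le_trans; rewrite ler_wpM2r //.
    by rewrite lerD2l lerN2.
  by apply: le_trans epG; rewrite lerD2l.
have cV' : #|V| = (s.-1 + (n - s + 1))%N.
  by rewrite cV addn1 addnS -addSn prednK // subnKC.
have [|L GL] := @graph_iso_join V G A s.-1 (n - s + 1) cA cV'.
  by move=> a /fullA; rewrite cV.
exists L => //.
have Lfree := graph_iso_free GL free.
apply: (@near_regular_sum_max R p s.-1) => // [w|].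
  exact: join_free_degree Lfree.
move: epG; rewrite (e_p_iso p GL) e_p_join_complete card_ord.
have -> : (s.-1.-1 + (n - s + 1))%N = n.-1.
  by rewrite -[in RHS]cV cV'; case: (s) s1 => [|[]].
by rewrite lerD2l.
Qed.

Theorem theorem1p6 (R : realType) (s t : nat) (p : R)
    (hs : (2 <= s)%N) (hst : (s <= t)%N) (hp : s%:R < p) :
  exists n0 : nat, forall n : nat, (n0 <= n)%N ->
  forall (V : finType) (G : sgraph V), #|V| = n ->
  graph_free (complete_bipartite s t) G ->
  (extremal_graph p n (complete_bipartite s t) G <->
   exists L : sgraph 'I_(n - s + 1),
     [/\ near_regular (t - 1) L,
         (forall a b : nat, (2 <= a)%N -> (a <= minn b s)%N ->
            (a + b = t + 1)%N -> ~ contains_graph L (complete_bipartite a b)) &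
         graph_iso G (graph_join (complete_graph (s - 1)) L)]).
Proof.
have s0 : (0 < s)%N := ltnW hs.
have t0 : (0 < t)%N := leq_trans s0 hst.
have [n1 structure] := extremal_structure hs t0 hp.
have [m0 exL] := exists_near_regular t.-1.
exists (maxn s (maxn n1 m0 + s)) => n; rewrite geq_max => /andP[sn ns].
have n1n : (n1 <= n)%N by lia.
have m0m : (m0 <= n - s + 1)%N by lia.
rewrite (subn1 s) (subn1 t) => V G cV free.
(* The common value of [e_p] on all joins of [K_(s-1)] with a near [(t-1)]-regular graph. *)
pose F := s.-1%:R * n.-1%:R `^ p + near_regular_sum p s.-1 t.-1 (n - s + 1).
have valF (W : finType) (H : sgraph W) (L : sgraph 'I_(n - s + 1)) :
    near_regular t.-1 L -> graph_iso H (graph_join (complete_graph s.-1) L) ->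
    e_p p H = F.
  move=> nrL HL; rewrite (e_p_iso p HL) e_p_join_complete.
  rewrite (near_regular_sumE p _ nrL) card_ord; congr (_ * _%:R `^ _ + _); lia.
(* One [K_(s,t)]-free join of this kind suffices to place [F] below the maximum, so
   [extremal_structure] applies to every extremal graph. *)
have [L0 [nrL0 quadL0]] := exL _ m0m.
have L0free := @join_quad_free_free _ L0 s t ltac:(by rewrite s0) quadL0
  (fun v => near_regular_degree_le v nrL0).
have [H0 JH0] : exists H : sgraph 'I_n,
    graph_iso (graph_join (complete_graph s.-1) L0) H.
  by apply: relabel; rewrite card_sum !card_ord; lia.
have H0free := graph_iso_free JH0 L0free.
have F_le : F <= ex_p p n (complete_bipartite s t).
  by rewrite -(valF _ _ _ nrL0 (graph_iso_sym JH0)); exact: ex_p_ub.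
split=> [[_ _ epG]|[L [nrL _ GL]]].
  have [|L nrL GL] := structure n n1n V G cV free; first by rewrite epG.
  exists L; split=> // a b a2; rewrite leq_min => /andP[_ as_] ab.
  apply: (@join_free_bipartite _ L s t a b (graph_iso_free GL free)); last by rewrite ab addn1.
  by rewrite as_ ltnW.
split=> //.
(* A maximiser is also a join of this kind, so the maximum equals [F], the value at [G]. *)
have [H Hfree epH] := @ex_p_attained R p n _ _ H0 H0free.
have [|L' nrL' HL'] := structure n n1n _ H (card_ord n) Hfree; first by rewrite epH.
by rewrite (valF _ _ _ nrL GL) -epH (valF _ _ _ nrL' HL').
Qed.
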